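(* Let $(u_h^0,\dot d_h^0,d_h^0)\in V_h\times W_h\times W_h$ be initial values and, for $n\ge1$, let $(u_h^n,p_h^n,\dot d_h^n,d_h^n,\lambda_h^n)\in V_h\times Q_h\times W_h\times W_h\times\Lambda_h$ be the solution of Algorithm 3 (described in the context) with extrapolation order $r\in\{0,1,2\}$. Let $$E_h^n=\rho_f\|u_h^n\|_{0,\Omega}^2+\rho_s\epsilon\|\dot d_h^n\|_{0,\Sigma}^2+\|d_h^n\|_s^2\quad(n\ge0),$$ $$D_h^n=\tau\sum_{k=1}^n\big(\|\varepsilon(u_h^k)\|_{0,\Omega}^2+|p_h^k|_{s_h}^2\big)+\tau^2\sum_{k=1}^n\big(\rho_f\|\partial_\tau u_h^k\|_{0,\Omega}^2+\rho_s\epsilon\|\partial_\tau\dot d_h^k\|_{0,\Sigma}^2+\|\partial_\tau d_h^k\|_s^2\big)\quad(n\ge1).$$ Then, for all $n\ge1$, the following hold (where $a\lesssim b$ means $a\le Cb$ with $C>0$ independent of $n,\tau,h_f,h_s$ and the initial data): (i) for $r=0$: $$E_h^n+D_h^n+\frac{\tau^2}{4\rho_s\epsilon}\sum_{m=1}^n\|L_h^sd_h^m\|_{0,\Sigma}^2\lesssim E_h^0;$$ (ii) for $r=1$: $$E_h^n+D_h^n+\frac{\tau^2}{2\rho_s\epsilon}\sum_{m=1}^n\|L_h^s(d_h^m-d_h^{m-1})\|_{0,\Sigma}^2+\frac{\tau^2}{2}\sum_{m=1}^n\|\dot d_h^m-\dot d_h^{m-1}\|_s^2+\frac{\tau^2}{2\rho_s\epsilon}\|L_h^sd_h^n\|_{0,\Sigma}^2+\frac{\tau^2}{2}\|\dot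 d_h^n\|_s^2$$ $$\lesssim E_h^0+\frac{\tau^2}{2}\|\dot d_h^0\|_s^2+\frac{\tau^2}{2\rho_s\epsilon}\|L_h^sd_h^0\|_{0,\Sigma}^2;$$ (iii) for $r=2$, if $\tau$ and $h_s$ are such that there exists $\alpha>0$ with $$\frac{\tau^5}{h_s^6}\frac{\beta_s^3C_I^6}{(\rho_s\epsilon)^3}\le\alpha^5,\qquad 2\tau\alpha^5<1,$$ then $$\tau^2\sum_{m=1}^n\|\dot d_h^m-\dot d_h^{m-1}\|_s^2+E_h^n+D_h^n\lesssim\exp\Big(\tau\sum_{m=1}^n\frac{2\alpha^5}{1-2\tau\alpha^5}\Big)E_h^0 .$$
   Context: Let $d\in\{2,3\}$, $\Omega\subset\mathbb R^d$ a polygonal domain, $\Sigma$ a fixed $(d-1)$-dimensional reference configuration (a polygonal domain, e.g. an interval if $d=2$), $\phi_0:\Sigma\to\Omega$ its position map. Constants $\rho_f,\rho_s,\epsilon,\mu>0$. $(\cdot,\cdot)_{0,\cdot}$ are $L^2$ scalar products; $\varepsilon(u)=\frac12(\nabla u+\nabla u^T)$. $V=H^1_0(\Omega)^d$; $Q=L^2_0(\Omega)$; $W\subset H^1(\Sigma)^d$ is the closed subspace of admissible solid displacements (homogeneous Dirichlet conditions, if any). $a^s:W\times W\to\mathbb R$ is symmetric, bilinear, coercive for the $H^1(\Sigma)$-norm and continuous with constant $\beta_s$: $a^s(d,w)\le\beta_s\|d\|_{1,\Sigma}\|w\|_{1,\Sigma}$; $\|w\|_s=a^s(w,w)^{1/2}$.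 Discretization: $\{\mathcal T_h\}$ is a regular family of simplicial triangulations of $\Omega$ with maximal mesh size $h_f$ ($h_K$ the diameter of $K$), $\{\mathcal S_h\}$ a quasi-uniform family of simplicial triangulations of $\Sigma$ with mesh size $h_s$. With $X_h$, $Y_h$ the spaces of continuous piecewise affine functions on $\mathcal T_h$, $\mathcal S_h$: $V_h=V\cap X_h^d$, $Q_h=Q\cap X_h$, $W_h=W\cap Y_h^d$, $\Lambda_h=Y_h^d$. $C_I$ is the constant of the inverse inequality $\|w_h\|_{1,\Sigma}\le C_Ih_s^{-1}\|w_h\|_{0,\Sigma}$ for $w_h\in W_h$. On discrete functions $c(\cdot,\cdot)$ is the $L^2(\Sigma)^d$ scalar product. $s_h(p_h,q_h)=\gamma\sum_Kh_K^2\int_K\nabla p_h\cdot\nabla q_h$, $\gamma>0$ fixed, $|q_h|_{s_h}^2=s_h(q_h,q_h)$, and $$a_h^f((u_h,p_h),(v_h,q_h))=2\mu(\varepsilon(u_h),\varepsilon(v_h))_{0,\Omega}-(p_h,\operatorname{div}v_h)_{0,\Omega}+(q_h,\operatorname{div}u_h)_{0,\Omega}+s_h(p_h,q_h).$$ The discrete elastic operator $L_h^s:W\to W_h$ is defined by $(L_h^sw,w_h)_{0,\Sigma}=a^s(w,w_h)$ for all $w_h\in W_h$. Time step $\tau>0$; $\partial_\tau g^n=(g^n-g^{n-1})/\tau$. Algorithm 3. Extrapolation of order $r$: $d_h^{n\star}=0$ if $r=0$; $d_h^{n\star}=d_h^{n-1}$ if $r=1$; $d_h^{n\star}=d_h^{n-1}+\tau\dot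 d_h^{n-1}$ if $r=2$. With $\phi_h^0=\phi_0+d_h^0$, for $n\ge1$: (1) find $(u_h^n,p_h^n,\dot d_h^{n-1/2},\lambda_h^n)\in V_h\times Q_h\times W_h\times\Lambda_h$ such that for all $(v_h,q_h,w_h,\mu_h)\in V_h\times Q_h\times W_h\times\Lambda_h$ $$\rho_f(\partial_\tau u_h^n,v_h)_{0,\Omega}+a_h^f((u_h^n,p_h^n),(v_h,q_h))+c(\lambda_h^n,v_h\circ\phi_h^{n-1}-w_h)-c(\mu_h,u_h^n\circ\phi_h^{n-1}-\dot d_h^{n-1/2})+\tfrac{\rho_s\epsilon}{\tau}(\dot d_h^{n-1/2}-\dot d_h^{n-1},w_h)_{0,\Sigma}=-a^s(d_h^{n\star},w_h);$$ (2) find $(d_h^n,\dot d_h^n)\in W_h\times W_h$ with $\partial_\tau d_h^n=\dot d_h^n$ and $\tfrac{\rho_s\epsilon}{\tau}(\dot d_h^n-\dot d_h^{n-1/2},z_h)_{0,\Sigma}+a^s(d_h^n-d_h^{n\star},z_h)=0$ for all $z_h\in W_h$; (3) $\phi_h^n=\phi_0+d_h^n$. It is assumed that $\phi_h^n(\Sigma)\subset\Omega$ for all $n$, so the compositions are defined. *)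

(* Defs.v *)
From HB Require Import structures.
From mathcomp Require Import all_boot all_order all_algebra.
From mathcomp Require Import all_classical all_reals all_analysis.

Set Implicit Arguments.
Unset Strict Implicit.
Unset Printing Implicit Defensive.

Import Order.TTheory GRing.Theory Num.Theory numFieldNormedType.Exports.

Local Open Scope classical_set_scope.
Local Open Scope ring_scope.

Section LebesgueMeasure.
Context {R : realType}.

Definition rV_coord n (i : 'I_n) (x : 'rV[R]_n) : measurableTypeR R := x 0 i.

Section rV_measurable.
Variable n : nat.

Let rV_set0 : g_sigma_preimage (@rV_coord n) set0.
Proof. exact: sigma_algebra0. Qed.

Let rV_setC A : g_sigma_preimage (@rV_coord n) A ->
  g_sigma_preimage (@rV_coord n) (~` A).
Proof. exact: sigma_algebraC. Qed.

Let rV_bigcup (F : _^nat) : (forall i, g_sigma_preimage (@rV_coord n) (F i)) ->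
  g_sigma_preimage (@rV_coord n) (\bigcup_i (F i)).
Proof. exact: sigma_algebra_bigcup. Qed.

(* The product sigma-algebra of R^n, which is its Borel sigma-algebra. *)
HB.instance Definition _ := @isMeasurable.Build default_measure_display
  'rV[R]_n (g_sigma_preimage (@rV_coord n)) rV_set0 rV_setC rV_bigcup.

End rV_measurable.

Definition rV_cons n (p : measurableTypeR R * 'rV[R]_n) : 'rV[R]_n.+1 :=
  \row_i oapp (p.2 0) p.1 (unlift ord0 i).

Definition rV_uncons n (x : 'rV[R]_n.+1) : measurableTypeR R * 'rV[R]_n :=
  (x 0 0, \row_j x 0 (lift ord0 j)).

Lemma measurable_rV_coord n (i : 'I_n) :
  measurable_fun [set: 'rV[R]_n] (@rV_coord n i).
Proof.
move=> _ Y mY; rewrite setTI; apply: sub_sigma_algebra => /=.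
rewrite -bigcup_seq/=; exists i => /=; first by rewrite mem_index_enum.
by exists Y => //; rewrite setTI.
Qed.

Lemma measurable_to_rV d (T : measurableType d) n (f : T -> 'rV[R]_n) :
  (forall i, measurable_fun [set: T] (@rV_coord n i \o f)) ->
  measurable_fun [set: T] f.
Proof.
move=> mf.
suff H : g_sigma_preimage (fun i => @rV_coord n i \o f) `<=` measurable.
  move=> _ A mA; apply: H; rewrite g_sigma_preimage_comp; exists A => //.
apply: smallest_sub; first exact: sigma_algebra_measurable.
case: n => [|n] in f mf *; first by rewrite big_ord0.
rewrite -bigcup_mkord_ord; apply: bigcup_sub => i Ii.
by move=> A [B mB <-]; exact: mf.
Qed.

Lemma measurable_rV_cons n : measurable_fun setT (@rV_cons n).
Proof.
apply: measurable_to_rV => i; case: (unliftP ord0 i) => [j|] ->.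
  rewrite (_ : _ \o _ = @rV_coord n j \o snd); last first.
    by apply/funext => p; rewrite /rV_coord/rV_cons/= mxE liftK.
  by apply: measurableT_comp => //; exact: measurable_rV_coord.
rewrite (_ : _ \o _ = fst); first exact: measurable_fst.
by apply/funext => p; rewrite /rV_coord/rV_cons/= mxE unlift_none.
Qed.

Lemma rV_consK n : cancel (@rV_cons n) (@rV_uncons n).
Proof.
case=> a x; congr pair; first by rewrite mxE unlift_none.
by apply/rowP => j; rewrite !mxE liftK.
Qed.

Lemma rV_unconsK n : cancel (@rV_uncons n) (@rV_cons n).
Proof.
move=> x; apply/rowP => i; rewrite mxE.
by case: (unliftP ord0 i) => [j|] ->; rewrite /= ?mxE.
Qed.

Lemma measurable_rV_uncons n : measurable_fun setT (@rV_uncons n).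
Proof.
apply/measurable_fun_pairP; split; first exact: measurable_rV_coord.
apply: measurable_to_rV => i.
rewrite (_ : _ \o _ = @rV_coord n.+1 (lift ord0 i)).
  exact: measurable_rV_coord.
by apply/funext => x; rewrite /rV_coord/= mxE.
Qed.

Section lebesgue_rVS.
Variables (n : nat) (m : {sigma_finite_measure set 'rV[R]_n -> \bar R}).

Definition lebesgue_rVS : set 'rV[R]_n.+1 -> \bar R :=
  pushforward (lebesgue_measure \x m)%E (@rV_cons n).

Let mcons (A : set 'rV[R]_n.+1) : measurable A ->
  measurable (@rV_cons n @^-1` A).
Proof. by move=> mA; rewrite -[X in measurable X]setTI; exact: measurable_rV_cons. Qed.

Let lebesgue_rVS0 : lebesgue_rVS set0 = 0%E.
Proof. by rewrite /lebesgue_rVS/pushforward preimage_set0 measure0. Qed.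

Let lebesgue_rVS_ge0 A : (0 <= lebesgue_rVS A)%E.
Proof. by rewrite /lebesgue_rVS/pushforward; exact: measure_ge0. Qed.

Let lebesgue_rVS_sigma_additive : semi_sigma_additive lebesgue_rVS.
Proof.
move=> F mF tF mUF; rewrite /lebesgue_rVS/pushforward preimage_bigcup.
apply: measure_semi_sigma_additive => [i||]; first exact: mcons.
- apply/trivIsetP => /= i j _ _ ij; rewrite -preimage_setI.
  by move/trivIsetP : tF => /(_ _ _ _ _ ij) ->//; rewrite preimage_set0.
- by rewrite -preimage_bigcup; exact: mcons.
Qed.

HB.instance Definition _ := isMeasure.Build _ _ _ lebesgue_rVS
  lebesgue_rVS0 lebesgue_rVS_ge0 lebesgue_rVS_sigma_additive.

Let lebesgue_rVS_sigma_finite : sigma_finite setT lebesgue_rVS.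
Proof.
have /sigma_finiteP[F [TF ndF Foo]] := sigma_finiteT (@lebesgue_measure R).
have /sigma_finiteP[G [TG ndG Goo]] := sigma_finiteT m.
exists (fun k => @rV_uncons n @^-1` (F k `*` G k)).
  rewrite -preimage_bigcup; apply/esym; rewrite -subTset => x _.
  have [i _ Fi] : (\bigcup_i F i) (rV_uncons x).1 by rewrite -TF.
  have [j _ Gj] : (\bigcup_i G i) (rV_uncons x).2 by rewrite -TG.
  exists (maxn i j) => //; split.
    by move: Fi; exact/subsetPset/ndF/leq_maxl.
  by move: Gj; exact/subsetPset/ndG/leq_maxr.
move=> k; have [mF Fk] := Foo k; have [mG Gk] := Goo k; split.
  rewrite -[X in measurable X]setTI; apply: measurable_rV_uncons => //.
  exact: measurableX.
rewrite /lebesgue_rVS/pushforward -comp_preimage.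
rewrite (_ : _ \o _ = id) ?preimage_id; last exact/funext/rV_consK.
by rewrite product_measure1E// lte_mul_pinfty// ge0_fin_numE.
Qed.

HB.instance Definition _ := Measure_isSigmaFinite.Build _ _ _ lebesgue_rVS
  lebesgue_rVS_sigma_finite.

End lebesgue_rVS.

(* The n-fold product of the Lebesgue measure of R. *)
Fixpoint lebesgue_rV n : {sigma_finite_measure set 'rV[R]_n -> \bar R} :=
  match n with
  | 0 => dirac (0 : 'rV[R]_0)
  | n'.+1 => lebesgue_rVS (lebesgue_rV n')
  end.

Lemma lebesgue_rV_box n (a b : 'rV[R]_n) : (forall i, a 0 i <= b 0 i) ->
  lebesgue_rV n [set x | forall i, a 0 i <= x 0 i <= b 0 i] =
  (\prod_i (b 0 i - a 0 i))%:E.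
Proof.
elim: n => [|n IH] in a b * => ab /=.
  by rewrite big_ord0 diracE (_ : _ \in _ = true)//; apply/mem_set => -[].
rewrite big_ord_recl EFinM.
pose a' := \row_i a 0 (lift ord0 i); pose b' := \row_i b 0 (lift ord0 i).
have {IH} := IH a' b'; under eq_bigr do rewrite !mxE.
move=> <-; last by move=> i; rewrite !mxE.
rewrite /lebesgue_rVS/pushforward.
rewrite (_ : _ @^-1` _ = `[a 0 0, b 0 0]%classic `*`
    [set x : 'rV_n | forall i, a' 0 i <= x 0 i <= b' 0 i]); last first.
  apply/seteqP; split => -[s x] /=.
    move=> H; split; first by have := H ord0; rewrite in_itv mxE unlift_none.
    by move=> i; have := H (lift ord0 i); rewrite !mxE liftK.
  rewrite in_itv /= => -[H0 H] i; case: (unliftP ord0 i) => [j|] ->.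
    by have := H j; rewrite !mxE liftK.
  by rewrite mxE unlift_none.
rewrite product_measure1E//; last first.
  rewrite (_ : [set _ | _] = \bigcap_(i in setT)
    ((@rV_coord n i) @^-1` `[a' 0 i, b' 0 i]%classic)); last first.
    apply/seteqP; split => x /= H i; first by move=> _; rewrite /= in_itv; exact: H.
    by have := H i I; rewrite /= in_itv.
  apply: fin_bigcap_measurable => // i _.
  by rewrite -[X in measurable X]setTI; exact: measurable_rV_coord.
congr (_ * _)%E.
apply: etrans (lebesgue_measure_itv `[a 0 0, b 0 0]) _.
rewrite /= lte_fin; case: ltP => // h.
by rewrite (_ : b 0 0 = a 0 0) ?subrr//; apply/le_anti; rewrite h ab.
Qed.

End LebesgueMeasure.

Section Simplices.
Context {R : realType} (n : nat).
Implicit Types (D : set 'rV[R]_n) (K : 'M[R]_(n.+1, n)).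
Implicit Types (T : seq 'M[R]_(n.+1, n)).

Definition enorm (x : 'rV[R]_n) : R := Num.sqrt (\sum_i x 0 i ^+ 2).

(* A simplex is given by the matrix K of its vertices (one per row); [face K I]
   is the convex hull of the vertices with index in I. *)
Definition face K (I : {set 'I_n.+1}) : set 'rV[R]_n :=
  [set x | exists l : 'rV[R]_n.+1,
    [/\ forall i, 0 <= l 0 i, forall i, i \notin I -> l 0 i = 0,
        \sum_i l 0 i = 1 & x = l *m K]].

Definition hull K : set 'rV[R]_n := face K [set: 'I_n.+1].

(* The edges issued from the first vertex are linearly independent. *)
Definition nondegenerate K : Prop :=
  \det (\matrix_(i < n) (row (lift ord0 i) K - row ord0 K)) != 0.

(* The interior of a finite union of closed nondegenerate simplices, provided
   it is nonempty and connected. *)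
Definition polygonal_domain D : Prop :=
  [/\ D !=set0, connected D &
      exists T, (forall K, K \in T -> nondegenerate K) /\
        D = interior (\bigcup_(K in [set` T]) hull K)].

Definition triangulation D T : Prop :=
  [/\ uniq T,
      forall K, K \in T -> nondegenerate K,
      \bigcup_(K in [set` T]) hull K = closure D,
      (* the same simplex is not listed twice with permuted vertices *)
      {in T &, forall K K', hull K = hull K' -> K = K'} &
      (* two simplices meet in the face spanned by their common vertices *)
      {in T &, forall K K', hull K `&` hull K' =
         face K [set i | [exists j, row i K == row j K']]}].

Definition diameter (A : set 'rV[R]_n) : R :=
  sup [set r | exists x y, [/\ A x, A y & r = enorm (x - y)]].

Definition inball_diameter (A : set 'rV[R]_n) : R :=
  sup [set r | exists c s, [/\ 0 <= s, r = 2 * s &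
                               [set x | enorm (x - c) <= s] `<=` A]].

Definition mesh_size T : R := \big[Num.max/0]_(K <- T) diameter (hull K).

Definition regular_family (I : Type) (T : I -> seq 'M[R]_(n.+1, n)) : Prop :=
  exists2 s : R, 0 < s & forall h K, K \in T h ->
    diameter (hull K) <= s * inball_diameter (hull K).

Definition quasi_uniform_family (I : Type) (T : I -> seq 'M[R]_(n.+1, n)) :
    Prop :=
  regular_family T /\
  exists2 s : R, 0 < s & forall h K, K \in T h ->
    s * mesh_size (T h) <= diameter (hull K).

End Simplices.

(* Fields on a domain D of R^n are total functions on R^n, of which only the
   values on D (on its closure for finite element functions) are used. *)
Section Sobolev.
Context {R : realType} (n : nat).
Implicit Types (D : set 'rV[R]_n) (f g p : 'rV[R]_n -> R).

(* Scalar product of L^2(D)^(k x l); vector fields are the case k = 1. *)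
Definition ip D k l (u v : 'rV[R]_n -> 'M[R]_(k, l)) : R :=
  \int[lebesgue_rV n]_(x in D) (\sum_i \sum_j u x i j * v x i j).

Definition L2norm D k l (u : 'rV[R]_n -> 'M[R]_(k, l)) : R :=
  Num.sqrt (ip D u u).

Definition sip D f g : R := \int[lebesgue_rV n]_(x in D) (f x * g x).

Definition in_L2 D f : Prop :=
  measurable_fun D f /\
  (\int[lebesgue_rV n]_(x in D) (f x ^+ 2)%:E < +oo)%E.

Definition in_L20 D f : Prop :=
  in_L2 D f /\ \int[lebesgue_rV n]_(x in D) f x = 0.

Definition partial (i : 'I_n) f : 'rV[R]_n -> R :=
  fun x => 'D_(delta_mx 0 i) f x.

Definition smooth f : Prop :=
  forall (s : seq 'I_n) x, differentiable (foldr partial f s) x.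

Definition test_function D f : Prop :=
  [/\ smooth f, compact (closure [set x | f x != 0]) &
      closure [set x | f x != 0] `<=` D].

Definition weak_derivative D (i : 'I_n) f g : Prop :=
  in_L2 D g /\
  forall phi, test_function D phi -> sip D f (partial i phi) = - sip D g phi.

Definition in_H1 D f : Prop :=
  in_L2 D f /\ forall i, exists g, weak_derivative D i f g.

(* A representative of the weak derivative (unique up to a null set), when it
   exists. *)
Definition weak_partial D (i : 'I_n) f : 'rV[R]_n -> R :=
  xget (fun=> 0) [set g | weak_derivative D i f g].

Definition grad D p (x : 'rV[R]_n) : 'rV[R]_n :=
  \row_i weak_partial D i p x.

Definition comp_fun m (k : 'I_m) (u : 'rV[R]_n -> 'rV[R]_m) : 'rV[R]_n -> R :=
  fun x => u x 0 k.

Definition jac D m (u : 'rV[R]_n -> 'rV[R]_m) (x : 'rV[R]_n) : 'M[R]_(m, n) :=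
  \matrix_(k, i) weak_partial D i (comp_fun k u) x.

Definition in_H1v D m (u : 'rV[R]_n -> 'rV[R]_m) : Prop :=
  forall k, in_H1 D (comp_fun k u).

Definition H1norm D m (u : 'rV[R]_n -> 'rV[R]_m) : R :=
  Num.sqrt (ip D u u + ip D (jac D u) (jac D u)).

(* H^1_0(D)^m, as the closure of the test functions in H^1(D)^m. *)
Definition in_H10v D m (u : 'rV[R]_n -> 'rV[R]_m) : Prop :=
  in_H1v D u /\
  forall e, 0 < e -> exists phi : 'rV[R]_n -> 'rV[R]_m,
    (forall k, test_function D (comp_fun k phi)) /\ H1norm D (u - phi) < e.

(* Closedness makes W stable under almost everywhere modification. *)
Definition closed_subspace_H1 D m (W : set ('rV[R]_n -> 'rV[R]_m)) : Prop :=
  [/\ forall u, W u -> in_H1v D u,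
      W 0,
      forall u v, W u -> W v -> W (u + v),
      forall a u, W u -> W (a *: u) &
      forall u, in_H1v D u ->
        (forall e, 0 < e -> exists2 w, W w & H1norm D (u - w) < e) -> W u].

Definition P1 D (T : seq 'M[R]_(n.+1, n)) f : Prop :=
  {within closure D, continuous f} /\
  forall K, K \in T -> exists (a : 'cV[R]_n) (b : R),
    forall x, hull K x -> f x = (x *m a) 0 0 + b.

Definition P1v D (T : seq 'M[R]_(n.+1, n)) m (u : 'rV[R]_n -> 'rV[R]_m) :
    Prop :=
  forall k, P1 D T (comp_fun k u).

End Sobolev.

Section Flow.
Context {R : realType} (n : nat).
Implicit Types (D : set 'rV[R]_n) (u v : 'rV[R]_n -> 'rV[R]_n).
Implicit Types (p q : 'rV[R]_n -> R) (T : seq 'M[R]_(n.+1, n)).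

Definition strain D u (x : 'rV[R]_n) : 'M[R]_n :=
  2^-1 *: (jac D u x + (jac D u x)^T).

Definition divergence D u (x : 'rV[R]_n) : R := \tr (jac D u x).

Definition stab D T (gamma : R) p q : R :=
  gamma * \sum_(K <- T)
    diameter (hull K) ^+ 2 * ip (hull K) (grad D p) (grad D q).

Definition stab_norm D T gamma p : R := Num.sqrt (stab D T gamma p p).

Definition fluid_form D T (mu gamma : R) u p v q : R :=
  2 * mu * ip D (strain D u) (strain D v) - sip D p (divergence D v)
  + sip D q (divergence D u) + stab D T gamma p q.

Definition Vh D T : set ('rV[R]_n -> 'rV[R]_n) :=
  [set v | in_H10v D v /\ P1v D T v].

Definition Qh D T : set ('rV[R]_n -> R) :=
  [set q | in_L20 D q /\ P1 D T q].

End Flow.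

Section Solid.
Context {R : realType} (n m : nat).
Implicit Types (D : set 'rV[R]_n) (S : seq 'M[R]_(n.+1, n)).
Implicit Types (W : set ('rV[R]_n -> 'rV[R]_m)).
Implicit Types (a : ('rV[R]_n -> 'rV[R]_m) -> ('rV[R]_n -> 'rV[R]_m) -> R).

Definition Lambdah D S : set ('rV[R]_n -> 'rV[R]_m) := [set w | P1v D S w].

Definition Wh D W S : set ('rV[R]_n -> 'rV[R]_m) := W `&` Lambdah D S.

Definition elastic_form D W a (beta : R) : Prop :=
  [/\ forall u w, W u -> W w -> a u w = a w u,
      forall c u v w, W u -> W v -> W w ->
        a (c *: u + v) w = c * a u w + a v w,
      exists2 alpha, 0 < alpha &
        forall w, W w -> alpha * H1norm D w ^+ 2 <= a w w &
      forall u w, W u -> W w -> a u w <= beta * H1norm D u * H1norm D w].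

Definition energy_norm a w : R := Num.sqrt (a w w).

Definition inverse_inequality D (Wd : set ('rV[R]_n -> 'rV[R]_m)) (h CI : R) :
    Prop :=
  forall w, Wd w -> H1norm D w <= CI / h * L2norm D w.

Definition discrete_elastic_operator D W a
    (Wd : set ('rV[R]_n -> 'rV[R]_m))
    (L : ('rV[R]_n -> 'rV[R]_m) -> ('rV[R]_n -> 'rV[R]_m)) : Prop :=
  forall w, W w -> Wd (L w) /\ forall z, Wd z -> ip D (L w) z = a w z.

End Solid.

Definition dtau {R : realType} (E : lmodType R) (tau : R) (g : nat -> E)
    (n : nat) : E :=
  tau^-1 *: (g n - g n.-1).

Section Scheme.
Context {R : realType} (d m : nat).
Variables (Om : set 'rV[R]_d) (Sig : set 'rV[R]_m) (phi0 : 'rV[R]_m -> 'rV[R]_d).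
Variables (rhof rhos eps mu gamma : R).
Variable a : ('rV[R]_m -> 'rV[R]_d) -> ('rV[R]_m -> 'rV[R]_d) -> R.
Variables (T : seq 'M[R]_(d.+1, d)) (S : seq 'M[R]_(m.+1, m)).
Variables (W : set ('rV[R]_m -> 'rV[R]_d)) (tau : R).
(* [dhalf n] is the intermediate velocity with index n - 1/2; [p], [dhalf] and
   [lam] are only meaningful for n >= 1. *)
Variables (u : nat -> 'rV[R]_d -> 'rV[R]_d) (p : nat -> 'rV[R]_d -> R).
Variables (disp vel dhalf lam : nat -> 'rV[R]_m -> 'rV[R]_d).

(* Meant for r <= 2 and n >= 1. *)
Definition extrapolation (r n : nat) : 'rV[R]_m -> 'rV[R]_d :=
  match r with
  | 0 => 0
  | 1 => disp n.-1
  | _ => disp n.-1 + tau *: vel n.-1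
  end.

Definition position (n : nat) : 'rV[R]_m -> 'rV[R]_d := phi0 + disp n.

Definition algorithm3 (r : nat) : Prop :=
  [/\ forall n, [/\ Vh Om T (u n), Wh Sig W S (disp n) & Wh Sig W S (vel n)],
      forall n, (0 < n)%N ->
        [/\ Qh Om T (p n), Wh Sig W S (dhalf n) & Lambdah Sig S (lam n)],
      forall n, position n @` Sig `<=` Om,
      forall n, (0 < n)%N -> forall v q w l,
        Vh Om T v -> Qh Om T q -> Wh Sig W S w -> Lambdah Sig S l ->
        rhof * ip Om (dtau tau u n) v
        + fluid_form Om T mu gamma (u n) (p n) v q
        + ip Sig (lam n) (v \o position n.-1 - w)
        - ip Sig l (u n \o position n.-1 - dhalf n)
        + rhos * eps / tau * ip Sig (dhalf n - vel n.-1) w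
        = - a (extrapolation r n) w &
      (* members of W_h are functions on Sig: values elsewhere are irrelevant *)
      forall n, (0 < n)%N ->
        (forall x, Sig x -> dtau tau disp n x = vel n x) /\
        forall z, Wh Sig W S z ->
          rhos * eps / tau * ip Sig (vel n - dhalf n) z
          + a (disp n - extrapolation r n) z = 0].

Definition energy (n : nat) : R :=
  rhof * L2norm Om (u n) ^+ 2 + rhos * eps * L2norm Sig (vel n) ^+ 2
  + energy_norm a (disp n) ^+ 2.

Definition dissipation (n : nat) : R :=
  tau * (\sum_(1 <= k < n.+1)
    (L2norm Om (strain Om (u k)) ^+ 2 + stab_norm Om T gamma (p k) ^+ 2))
  + tau ^+ 2 * (\sum_(1 <= k < n.+1)
    (rhof * L2norm Om (dtau tau u k) ^+ 2
     + rhos * eps * L2norm Sig (dtau tau vel k) ^+ 2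
     + energy_norm a (dtau tau disp k) ^+ 2)).

End Scheme.

(* Main.v *)
(* Write d, v for the new displacement and velocity, d0, v0 for the old ones, h
   for the intermediate velocity, ds for the extrapolated displacement, and
   rho = rhos * eps.  Testing the first substep with its own solution cancels
   the coupling and pressure terms, and testing the second one with v and L ds
   turns the remaining power of the extrapolation into
   -2 tau^2/rho (L (d - ds), L ds).  Weakly h - v = (tau/rho) L (d - ds), so the
   correction dissipates exactly rho |v - h|^2 = tau^2/rho |L (d - ds)|^2.
   - If r = 0 the indefinite term vanishes.
   - If r = 1, then d - ds = tau v, the indefinite term and the correction add up
     to a telescoping tau^2/rho |L d|^2, and expanding h - v0 gives the
     telescoping tau^2 |v|_s^2.
   - If r = 2, then d - ds = tau (v - v0) and what is left is
     -2 tau^3/rho (L d, L (v - v0)); three uses of the inverse inequality bound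
     it by a multiple of |d|_s |v - v0|, which Young's inequality splits between
     the dissipation and 2 tau alpha^5 |d|_s^2, and Gronwall's lemma concludes. *)
Require Import Defs.
From mathcomp Require Import all_boot all_order all_algebra.
From mathcomp Require Import all_classical all_reals all_analysis.
From mathcomp Require Import measurable_realfun ring lra.

Import Order.TTheory GRing.Theory Num.Theory numFieldNormedType.Exports.

Local Open Scope classical_set_scope.
Local Open Scope ring_scope.

(** * Positive semidefinite symmetric forms on a subspace *)

Section SemiInner.
Set Implicit Arguments.
Unset Strict Implicit.
Context {R : realFieldType} {V : lmodType R}.
Variables (P : set V) (b : V -> V -> R).

(** The laws are asked on [P] only, since the integrals and the elastic form are meaningful on L^2
    or on the solid space and not on all total functions. Nonnegativity replaces definiteness: a
    total function that vanishes on the domain has norm zero. *)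
Definition semi_inner : Prop :=
  [/\ P 0, forall c x y, P x -> P y -> P (c *: x + y),
      forall x y, P x -> P y -> b x y = b y x,
      forall c x y z, P x -> P y -> P z ->
        b (c *: x + y) z = c * b x z + b y z &
      forall x, P x -> 0 <= b x x].

Hypothesis bP : semi_inner.

Lemma semi_inner_mem0 : P 0. Proof. by case: bP. Qed.

Lemma semi_inner_memB x y : P x -> P y -> P (x - y).
Proof.
by case: bP => _ + _ _ _ => h Px Py; rewrite addrC -scaleN1r; exact: h.
Qed.

Lemma semi_inner_memZ c x : P x -> P (c *: x).
Proof. by case: bP => P0 h _ _ _ Px; rewrite -[_ *: _]addr0; exact: h. Qed.

Lemma semi_innerC x y : P x -> P y -> b x y = b y x.
Proof. by case: bP => _ _ sym _ _; exact: sym. Qed.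

Lemma semi_inner_ge0 x : P x -> 0 <= b x x.
Proof. by case: bP => _ _ _ _; exact. Qed.

Lemma semi_innerBl x y z : P x -> P y -> P z -> b (x - y) z = b x z - b y z.
Proof.
case: bP => _ _ _ h _ Px Py Pz.
by rewrite addrC -scaleN1r h// mulN1r addrC.
Qed.

Lemma semi_inner0l z : P z -> b 0 z = 0.
Proof. by move=> Pz; rewrite -{1}(subrr z) semi_innerBl// subrr. Qed.

Lemma semi_innerZl c x z : P x -> P z -> b (c *: x) z = c * b x z.
Proof.
case: (bP) => P0 _ _ h _ Px Pz.
by rewrite -[_ *: _]addr0 h// semi_inner0l// addr0.
Qed.

Lemma semi_innerBr x y z : P x -> P y -> P z -> b z (x - y) = b z x - b z y.
Proof.
move=> Px Py Pz.
rewrite semi_innerC ?semi_innerBl//; last exact: semi_inner_memB.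
by rewrite ![b _ z]semi_innerC.
Qed.

Lemma semi_innerZr c x z : P x -> P z -> b z (c *: x) = c * b z x.
Proof.
move=> Px Pz.
rewrite semi_innerC ?semi_innerZl//; last exact: semi_inner_memZ.
by rewrite [b _ z]semi_innerC.
Qed.

Lemma semi_innerBB x y : P x -> P y ->
  b (x - y) (x - y) = b x x - 2 * b x y + b y y.
Proof.
move=> Px Py; have PB := semi_inner_memB Px Py.
rewrite semi_innerBl// !semi_innerBr// [b y x]semi_innerC//; ring.
Qed.

Lemma semi_inner_CS x y : P x -> P y -> b x y ^+ 2 <= b x x * b y y.
Proof.
move=> Px Py.
have h c : 0 <= c ^+ 2 * b x x - 2 * c * b x y + b y y.
  have := semi_inner_ge0 (semi_inner_memB (semi_inner_memZ c Px) Py).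
  rewrite semi_innerBB//; last exact: semi_inner_memZ.
  rewrite !semi_innerZl ?semi_innerZr//; last exact: semi_inner_memZ.
  by congr (_ <= _); ring.
have xx := semi_inner_ge0 Px; have yy := semi_inner_ge0 Py.
have [xx0|xx0] := eqVneq (b x x) 0.
  rewrite xx0 mul0r.
  have [->|xy0] := eqVneq (b x y) 0; first by rewrite expr0n.
  (* With [b x x = 0] the quadratic of [h] is affine in [c], and this [c] gives it the value -1. *)
  have := h ((b y y + 1) / (2 * b x y)).
  rewrite xx0 mulr0 add0r.
  have -> : 2 * ((b y y + 1) / (2 * b x y)) * b x y = b y y + 1.
    by field; exact: xy0.
  by move=> ?; exfalso; lra.
have := h (b x y / b x x).
have xxp : 0 < b x x by rewrite lt_neqAle eq_sym xx0.
have -> : (b x y / b x x) ^+ 2 * b x x - 2 * (b x y / b x x) * b x y + b y y =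
  (b x x * b y y - b x y ^+ 2) / b x x by field.
by rewrite pmulr_lge0 ?invr_gt0// subr_ge0.
Qed.

End SemiInner.

(** * Energy identities and estimates of one time step, in abstract form *)

Section SolidStep.
Set Implicit Arguments.
Unset Strict Implicit.
Context {R : realFieldType} {V : lmodType R}.
Variables (H W Wd : set V) (ip a : V -> V -> R) (L : V -> V).
Hypotheses (ipP : semi_inner H ip) (aP : semi_inner W a).
Hypotheses (WH : W `<=` H) (WdW : Wd `<=` W).
Hypothesis LP : forall w, W w ->
  Wd (L w) /\ forall z, Wd z -> ip (L w) z = a w z.

Let LWd w : W w -> Wd (L w). Proof. by move=> /LP[]. Qed.
Let LE w z : W w -> Wd z -> ip (L w) z = a w z.
Proof. by move=> /LP[_]; exact. Qed.

Lemma ip_operator w z : W w -> W z -> ip (L w) (L z) = a w (L z).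
Proof. by move=> Ww Wz; rewrite LE//; exact: LWd. Qed.

(** The operator [L] is specified only through its products with elements of [Wd], so its linearity
    is stated under [ip]. *)
Lemma ip_operatorBl w w' z : W w -> W w' -> Wd z ->
  ip (L (w - w')) z = ip (L w) z - ip (L w') z.
Proof.
move=> Ww Ww' Wdz; have Wz := WdW Wdz.
rewrite !LE ?(semi_innerBl aP)//; exact: (semi_inner_memB aP).
Qed.

Lemma norm_operatorB w w' : W w -> W w' ->
  ip (L (w - w')) (L (w - w')) =
  ip (L w) (L w) - 2 * ip (L w) (L w') + ip (L w') (L w').
Proof.
move=> Ww Ww'; have Wdiff := semi_inner_memB aP Ww Ww'.
have HL z : W z -> H (L z) by move=> /LWd/WdW/WH.
rewrite ip_operatorBl//; last exact: LWd.
rewrite (semi_innerC ipP (HL _ Ww) (HL _ Wdiff)).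
rewrite (semi_innerC ipP (HL _ Ww') (HL _ Wdiff)) .
rewrite !ip_operatorBl//; [|exact: LWd..].
rewrite (semi_innerC ipP (HL _ Ww') (HL _ Ww)); ring.
Qed.

(* [ds] is the extrapolated displacement, [k] stands for tau / rho, and [F] is
   the power of the fluid. *)
Variables (rho tau k F : R) (d d0 v v0 h ds : V).
Hypotheses (krho : k * rho = tau) (k0 : 0 < k).
Hypotheses (Wdd : Wd d) (Wdd0 : Wd d0) (Wdv : Wd v) (Wdv0 : Wd v0) (Wdh : Wd h).
Hypothesis Wds : W ds.
Hypothesis fluid_step : F + rho / tau * ip (h - v0) h = - a ds h.
Hypothesis solid_step : forall z, Wd z ->
  rho / tau * ip (v - h) z + a (d - ds) z = 0.
Hypothesis velocity : forall z, W z -> a (d - d0) z = tau * a v z.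
Hypothesis rho0 : 0 < rho.

Let tau0 : 0 < tau. Proof. by rewrite -krho mulr_gt0. Qed.
Let rhotau : rho / tau = k^-1.
Proof. by rewrite -krho invfM mulrCA mulfV ?mulr1// gt_eqF. Qed.

Lemma correctionE z : Wd z -> ip h z - ip v z = k * a (d - ds) z.
Proof.
move=> Wdz; have := solid_step Wdz.
rewrite rhotau (semi_innerBl ipP); try by [exact/WH/WdW].
move=> /(congr1 ( *%R k)); rewrite mulr0 mulrDr mulrA divff ?gt_eqF// mul1r.
by move=> e; lra.
Qed.

(** Testing [correctionE] with [h] and with [v] gives |v - h|^2 = k (L (d - ds), h - v); testing it
    with [L (d - ds)] turns this into k^2 |L (d - ds)|^2. *)
Lemma norm_correction :
  rho * ip (v - h) (v - h) = tau * k * ip (L (d - ds)) (L (d - ds)).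
Proof.
have We := semi_inner_memB aP (WdW Wdd) Wds.
have Hh := WH (WdW Wdh); have Hv := WH (WdW Wdv).
have e1 := correctionE Wdh; have e2 := correctionE Wdv.
have e3 := correctionE (LWd We).
move: e1 e2 e3; rewrite -!(LE We)//; last exact: LWd.
have HLe := WH (WdW (LWd We)).
rewrite (semi_innerC ipP HLe Hh) (semi_innerC ipP HLe Hv).
rewrite (semi_innerBB ipP)// (semi_innerC ipP Hh Hv) -krho => e1 e2 e3.
have -> : ip v v - 2 * ip v h + ip h h = k * (k * ip (L (d - ds)) (L (d - ds))).
  rewrite -e3 mulrBr -e1 -e2; ring.
by ring.
Qed.

(** Each of 2 (h - v0, h), 2 (v - h, v) and 2 a (d - d0, d) is a difference of squares plus the
    square of an increment. In the weighted sum the squares of [h] cancel, and the remaining elastic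
    work -2 tau a (ds, h - v) is rewritten by [correctionE] tested with [L ds]. *)
Lemma step_balance :
  2 * tau * F + rho * (ip v v - ip v0 v0 + ip (h - v0) (h - v0))
  + rho * ip (v - h) (v - h) + (a d d - a d0 d0 + a (d - d0) (d - d0))
  = - 2 * tau * k * ip (L (d - ds)) (L ds).
Proof.
have Hh := WH (WdW Wdh); have Hv := WH (WdW Wdv); have Hv0 := WH (WdW Wdv0).
have Wdn := WdW Wdd; have Wd0n := WdW Wdd0; have Wvn := WdW Wdv.
have Whn := WdW Wdh; have We := semi_inner_memB aP Wdn Wds.
have HLs := WH (WdW (LWd Wds)).
have c1 := correctionE Wdv; have c2 := correctionE (LWd Wds).
have vel := velocity Wdn; have fl := fluid_step.
move: fl c1 c2.
rewrite -(LE We (LWd Wds)); set Q := ip (L (d - ds)) (L ds).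
rewrite (semi_innerC ipP Hh HLs) (semi_innerC ipP Hv HLs).
rewrite !(LE Wds)// !(semi_innerBB ipP)// (semi_innerBB aP)//.
rewrite (semi_innerBl aP)// (semi_innerBl ipP)//.
rewrite (semi_innerC ipP Hh Hv0) (semi_innerC ipP Hh Hv).
rewrite (semi_innerC aP Wdn Wvn) rhotau => fl c1 c2.
rewrite (semi_innerBl aP)// (semi_innerC aP Wd0n Wdn) in vel.
have {}fl : k * F = - (ip h h - ip v0 h) - k * a ds h.
  have -> : F = - a ds h - k^-1 * (ip h h - ip v0 h) by lra.
  by field; rewrite gt_eqF.
have -> : 2 * tau * F = 2 * rho * (k * F) by rewrite -krho; ring.
rewrite fl -krho.
have -> : ip v h = ip v v + k * (a v d - a ds v) by rewrite -c1; ring.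
have -> : a d d0 = a d d - k * rho * a v d by rewrite krho -vel; ring.
have -> : -2 * (k * rho) * k * Q = -2 * (k * rho) * (k * Q) by ring.
rewrite -c2; ring.
Qed.

(** Expand h - v0 = (h - v) + (v - v0); the square of h - v is given by [norm_correction] and the
    cross term by [correctionE]. *)
Lemma norm_prediction :
  rho * ip (h - v0) (h - v0) =
  tau * k * ip (L (d - ds)) (L (d - ds)) + 2 * tau * a (d - ds) (v - v0)
  + rho * ip (v - v0) (v - v0).
Proof.
have Hh := WH (WdW Wdh); have Hv := WH (WdW Wdv); have Hv0 := WH (WdW Wdv0).
have We := semi_inner_memB aP (WdW Wdd) Wds.
have c1 := correctionE Wdv; have c2 := correctionE Wdv0.
rewrite -norm_correction (semi_innerBr aP)//; [|exact: WdW..].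
rewrite -krho.
rewrite (_ : 2 * (k * rho) * _ =
  2 * rho * (k * a (d - ds) v - k * a (d - ds) v0)); last by ring.
rewrite -c1 -c2 !(semi_innerBB ipP)//.
rewrite (semi_innerC ipP Hh Hv); ring.
Qed.

(** The terms of [step_balance] that are kept unchanged for every extrapolation order. *)
Definition energy_step : R :=
  2 * tau * F + rho * (ip v v - ip v0 v0) + (a d d - a d0 d0)
  + a (d - d0) (d - d0).

Lemma energy_step_order0 : ds = 0 ->
  energy_step + rho / 4 * ip (v - v0) (v - v0) + tau * k / 2 * ip (L d) (L d)
  <= 0.
Proof.
move=> ds0; have := step_balance; have := norm_correction.
have W0 := semi_inner_mem0 aP; have Ld := LWd (WdW Wdd).
have Hh := WH (WdW Wdh); have Hv := WH (WdW Wdv); have Hv0 := WH (WdW Wdv0).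
rewrite ds0 subr0.
have -> : ip (L d) (L 0) = 0.
  rewrite (semi_innerC ipP); [|exact/WH/WdW|exact/WH/WdW/LWd].
  by rewrite LE// (semi_inner0l aP)//; exact: WdW.
rewrite mulr0 /energy_step => nB bal.
have Hvh := semi_inner_memB ipP Hv Hh; have Hh0 := semi_inner_memB ipP Hh Hv0.
have : 0 <= rho * ip (h - v0) (h - v0).
  by rewrite mulr_ge0 ?(ltW rho0)//; exact: (semi_inner_ge0 ipP).
(* This yields |v - v0|^2 <= 2 |v - h|^2 + 2 |h - v0|^2. Half of rho |v - h|^2 pays for the term in
   [L d], and the other half, with half of rho |h - v0|^2, for rho/4 |v - v0|^2. *)
have : 0 <= rho * ip ((v - h) - (h - v0)) ((v - h) - (h - v0)).
  rewrite mulr_ge0 ?(ltW rho0)//.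
  exact/(semi_inner_ge0 ipP)/(semi_inner_memB ipP).
move: bal nB.
rewrite (semi_innerBB ipP Hvh Hh0) (semi_innerBl ipP Hv Hh Hh0).
rewrite !(semi_innerBB ipP)// !(semi_innerBr ipP)// (semi_innerC ipP Hh Hv0).
move=> *; lra.
Qed.

(** Nothing is estimated here. Prediction and correction each contribute tau k |L (d - d0)|^2: one
    copy completes 2 (L (d - d0), L d0) to |L d|^2 - |L d0|^2, the other stays. The cross term 2 tau
    a (d - d0, v - v0) equals 2 tau^2 a (v, v - v0), which telescopes as well. *)
Lemma energy_step_order1 : ds = d0 ->
  energy_step + rho * ip (v - v0) (v - v0)
  + tau ^+ 2 * (a v v - a v0 v0 + a (v - v0) (v - v0))
  + tau * k * ip (L (d - d0)) (L (d - d0))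
  + tau * k * (ip (L d) (L d) - ip (L d0) (L d0)) = 0.
Proof.
move=> dsE; have := step_balance; have := norm_prediction.
have := norm_correction.
have Wdn := WdW Wdd; have Wd0n := WdW Wdd0.
have Wv := WdW Wdv; have Wv0 := WdW Wdv0.
have Ww := semi_inner_memB aP Wv Wv0.
rewrite dsE velocity// (semi_innerBr aP Wv Wv0)// (semi_innerBB aP Wv Wv0).
rewrite norm_operatorB// (ip_operatorBl _ _ (LWd Wd0n))//.
rewrite /energy_step (semi_innerBB aP)//.
set X := ip (v - v0) (v - v0).
move=> *; lra.
Qed.

Lemma energy_step_order2 (K : R) : 0 <= K ->
  (forall w, Wd w -> a w w <= K * ip w w) -> Wd (v - v0) ->
  ds = d0 + tau *: v0 ->
  energy_step + rho / 2 * ip (v - v0) (v - v0)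
  + 2 * tau ^+ 2 * a (v - v0) (v - v0)
  <= 2 * (tau * k * K) ^+ 3 * a d d.
Proof.
move=> K0 inv Wdw dsE; have := step_balance; have := norm_prediction.
have nB := norm_correction.
have Wdn := WdW Wdd; have Wd0n := WdW Wdd0.
have Wv := WdW Wdv; have Wv0 := WdW Wdv0; have Ww := WdW Wdw.
have We := semi_inner_memB aP Wdn Wds.
have eE z : W z -> a (d - ds) z = tau * a (v - v0) z.
  have Wd0 := semi_inner_memB aP Wdn Wd0n.
  have Wtv0 := semi_inner_memZ aP tau Wv0.
  move=> Wz; rewrite dsE opprD addrA (semi_innerBl aP Wd0 Wtv0 Wz) velocity//.
  by rewrite (semi_innerZl aP)// (semi_innerBl aP Wv)// mulrBr.
have WdLe := LWd We; have WLe := WdW WdLe; have HLe := WH WLe.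
rewrite nB eE//.
(* Writing ds = d - (d - ds) produces +2 tau k |L (d - ds)|^2 on the right of the balance, which
   cancels exactly the contributions of prediction and correction on the left. Only -2 tau k a (d, L
   (d - ds)) remains to be bounded. *)
have -> : ip (L (d - ds)) (L ds) =
    a d (L (d - ds)) - ip (L (d - ds)) (L (d - ds)).
  rewrite (semi_innerC ipP HLe (WH (WdW (LWd Wds)))) (LE Wds WdLe).
  rewrite (ip_operator We We) (semi_innerBl aP)//; ring.
have X2 : a d (L (d - ds)) ^+ 2 <= a d d * (K * ip (L (d - ds)) (L (d - ds))).
  apply: le_trans (semi_inner_CS aP Wdn WLe) _.
  by rewrite ler_wpM2l ?inv//; exact: semi_inner_ge0 aP _ _.
(* The square of the left side is tau^2 a (v - v0, L (d - ds))^2. Cauchy-Schwarz and two inverse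
   inequalities bound it by a multiple of the left side itself, by which one then divides unless it
   is zero. *)
have Le2 : ip (L (d - ds)) (L (d - ds)) <=
    tau ^+ 2 * K ^+ 2 * ip (v - v0) (v - v0).
  have Y0 := semi_inner_ge0 ipP HLe.
  have w0 := semi_inner_ge0 ipP (WH Ww).
  have : ip (L (d - ds)) (L (d - ds)) ^+ 2 <=
      tau ^+ 2 * (K * ip (v - v0) (v - v0)) *
      (K * ip (L (d - ds)) (L (d - ds))).
    rewrite {1}ip_operator// eE// exprMn -mulrA ler_wpM2l ?sqr_ge0//.
    apply: le_trans (semi_inner_CS aP Ww WLe) _.
    by apply: ler_pM (inv _ Wdw) (inv _ WdLe); exact: (semi_inner_ge0 aP).
  set Y := ip (L (d - ds)) _ in Y0 *; set w := ip (v - v0) _ in w0 *.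
  have [-> _|Yn] := eqVneq Y 0; first by rewrite -exprMn mulr_ge0// sqr_ge0.
  have Yp : 0 < Y by rewrite lt_neqAle eq_sym Yn.
  move=> YY; rewrite -(ler_pM2r Yp); apply: le_trans YY _.
  by rewrite le_eqVlt; apply/orP; left; apply/eqP; ring.
move: X2 Le2.
set X := a d (L _); set Y := ip (L (d - ds)) _; set w := ip (v - v0) _.
set dd := a d d; move=> X2 Y2 pred bal.
have w0 : 0 <= w := semi_inner_ge0 ipP (WH Ww).
have dd0 : 0 <= dd := semi_inner_ge0 aP Wdn.
have {X2 Y2} X2 : X ^+ 2 <= dd * K ^+ 3 * tau ^+ 2 * w.
  apply: le_trans X2 _; rewrite -!mulrA ler_wpM2l//.
  apply: (@le_trans _ _ (K * (tau ^+ 2 * K ^+ 2 * w))); first exact: ler_wpM2l.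
  by rewrite le_eqVlt; apply/orP; left; apply/eqP; ring.
(* Young's inequality: [p] and [q] are the two terms that absorb [X]. *)
pose p := rho / 2 * w; pose q := 2 * (tau * k * K) ^+ 3 * dd.
have p0 : 0 <= p by rewrite !mulr_ge0// ltW.
have q0 : 0 <= q by rewrite mulr_ge0// mulr_ge0// exprn_ge0// !mulr_ge0// ltW.
have XX : (2 * tau * k * X) ^+ 2 <= (p + q) ^+ 2.
  apply: (@le_trans _ _ (4 * p * q)); last first.
    by rewrite -subr_ge0 (_ : _ - _ = (p - q) ^+ 2) ?sqr_ge0//; ring.
  (* Since [k * rho = tau], this product is exactly the bound obtained for (2 tau k X)^2; it
     dictates the coefficient of [q]. *)
  have -> : 4 * p * q = (2 * tau * k) ^+ 2 * (dd * K ^+ 3 * tau ^+ 2 * w).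
    by rewrite /p /q -krho; field.
  by rewrite exprMn ler_wpM2l// sqr_ge0.
have : - (2 * tau * k * X) <= p + q.
  apply: le_trans (ler_norm _) _; rewrite normrN.
  rewrite -(ler_pXn2r (n := 2)) ?nnegrE ?addr_ge0//.
  by rewrite real_normK// num_real.
rewrite /energy_step /p /q -/w -/dd => *; lra.
Qed.
End SolidStep.

(** * Measurability, L^2 products, Sobolev norms and the elastic form *)

Section Analysis.
Set Implicit Arguments.
Unset Strict Implicit.
Context {R : realType}.

(** An open set is the countable union of the boxes with rational centre and radius 1/(j+1) that it
    contains, and a box is a finite intersection of coordinate preimages. Polygonal domains, being
    interiors, are thus measurable. *)
Lemma open_measurable_rV n (A : set 'rV[R]_n) : open A -> measurable A.
Proof.
move=> oA.
pose box (q : 'rV[rat]_n * nat) : set 'rV[R]_n :=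
  [set x | forall i, `|x 0 i - ratr (q.1 0 i)| < q.2.+1%:R^-1].
have mbox q : measurable (box q).
  have -> : box q = \bigcap_(i in setT)
      ((@rV_coord R n i) @^-1` (ball (ratr (q.1 0 i) : R) q.2.+1%:R^-1)).
    apply/seteqP; split => x /= bx i.
      by move=> _; rewrite /= /ball /= distrC; exact: bx.
    by have := bx i I; rewrite /= /ball /= distrC.
  apply: fin_bigcap_measurable => // i _.
  rewrite -[X in measurable X]setTI; apply: measurable_rV_coord => //.
  apply: measurable_realfun.open_measurable; exact: ball_open.
rewrite (_ : A = \bigcup_q if `[< box q `<=` A >] then box q else set0).
  apply: countable_bigcupT_measurable => [|q]; first exact: countableP.
  by case: ifP.
apply/seteqP; split => [x Ax|x [q _]]; last by case: ifPn => // /asboolP; exact.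
have /nbhs_ballP[e /= e0 xe] := open_nbhs_nbhs (conj oA Ax).
(* Radius below e/2: a box containing [x] then lies in the ball of radius [e] around [x]. *)
have [k ke] : exists k, k.+1%:R^-1 < e / 2.
  have [k _ /(_ _ (leqnn k)) kP] : \forall k \near \oo, k.+1%:R^-1 < e / 2.
    by apply: near_infty_natSinv_lt (PosNum (divr_gt0 e0 (ltr0Sn _ 1))).
  by exists k.
have /choice[q qP] i : exists q : rat, `|x 0 i - ratr q| < k.+1%:R^-1.
  have /rat_in_itvoo[q] : x 0 i - k.+1%:R^-1 < x 0 i + k.+1%:R^-1.
    by rewrite ltrD2l gt0_cp// invr_gt0.
  rewrite in_itv/= => qP; exists q.
  by rewrite ltr_distlC.
exists (\row_i q i, k) => //; rewrite ifT; first by move=> i; rewrite mxE.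
apply/asboolP => y yq; apply: xe => /=; split => // i j; rewrite [i]ord1.
have := qP j; have := yq j; rewrite mxE/= => h1 h2.
rewrite /ball/=.
have -> : x 0 j - y 0 j = (x 0 j - ratr (q j)) - (y 0 j - ratr (q j)) by ring.
apply: le_lt_trans (ler_normB _ _) _.
by rewrite (splitr e) ltrD// (lt_trans _ ke).
Qed.

(** The product is dominated by f^2 + g^2. *)
Lemma integrable_mul_L2 n (D : set 'rV[R]_n) f g : measurable D ->
  in_L2 D f -> in_L2 D g ->
  (lebesgue_rV n).-integrable D (EFin \o (fun x => f x * g x)).
Proof.
move=> mD [mf f2] [mg g2].
have sq (h : 'rV[R]_n -> R) : measurable_fun D h ->
    (\int[lebesgue_rV n]_(x in D) (h x ^+ 2)%:E < +oo)%E ->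
    (lebesgue_rV n).-integrable D (EFin \o (fun x => h x ^+ 2)).
  move=> mh h2; apply/integrableP; split.
    by apply/measurable_EFinP; exact: measurable_funX.
  under eq_integral => x _ do rewrite /= ger0_norm ?sqr_ge0//.
  exact: h2.
have := integrableD mD (sq _ mf f2) (sq _ mg g2).
apply: le_integrable => //.
  by apply/measurable_EFinP; exact: measurable_funM.
move=> x _ /=; rewrite lee_fin [leRHS]ger0_norm ?addr_ge0 ?sqr_ge0//.
rewrite normrM -(real_normK (num_real (f x))) -(real_normK (num_real (g x))).
by have := sqr_ge0 (`|f x| - `|g x|); have := sqr_ge0 (`|f x| + `|g x|); nra.
Qed.

Lemma in_L2D n (D : set 'rV[R]_n) c f g : measurable D ->
  in_L2 D f -> in_L2 D g -> in_L2 D (fun x => c * f x + g x).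
Proof.
move=> mD Lf Lg; split.
  apply: measurable_funD; last by case: Lg.
  by apply: measurable_funM => //; case: Lf.
have ff := integrable_mul_L2 mD Lf Lf; have fg := integrable_mul_L2 mD Lf Lg.
have gg := integrable_mul_L2 mD Lg Lg.
have h := integrableD mD (integrableD mD (integrableZl mD (c ^+ 2) ff)
  (integrableZl mD (2 * c) fg)) gg.
apply: integrable_lty => //.
apply: eq_integrable h => // x _ /=.
by rewrite -!EFinM -!EFinD; congr EFin; ring.
Qed.

Definition L2v n (D : set 'rV[R]_n) m : set ('rV[R]_n -> 'rV[R]_m) :=
  [set u | forall k, in_L2 D (comp_fun k u)].

Lemma ip_rowE n (D : set 'rV[R]_n) m (u v : 'rV[R]_n -> 'rV[R]_m) :
  ip D u v =
  \int[lebesgue_rV n]_(x in D) \sum_k comp_fun k u x * comp_fun k v x.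
Proof. by rewrite /ip; apply: eq_Rintegral => x _; rewrite big_ord1. Qed.

Lemma integrable_ip n (D : set 'rV[R]_n) m (u v : 'rV[R]_n -> 'rV[R]_m) :
  measurable D -> L2v D u -> L2v D v ->
  (lebesgue_rV n).-integrable D
    (EFin \o (fun x => \sum_k comp_fun k u x * comp_fun k v x)).
Proof.
move=> mD Lu Lv.
rewrite (_ : _ \o _ = fun x => (\sum_k (comp_fun k u x * comp_fun k v x)%:E)%E).
  by apply: integrable_sum => // k _; exact: integrable_mul_L2.
by apply/funext => x; rewrite /= sumEFin.
Qed.

Lemma ip_ge0 n (D : set 'rV[R]_n) k l (u : 'rV[R]_n -> 'M[R]_(k, l)) :
  0 <= ip D u u.
Proof.
apply: Rintegral_ge0 => x _.
by do 2!apply: sumr_ge0 => ? _; rewrite -expr2 sqr_ge0.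
Qed.

Lemma semi_inner_ip n (D : set 'rV[R]_n) m : measurable D ->
  semi_inner (@L2v n D m) (@ip R n D 1 m).
Proof.
move=> mD; split => [k|c u v Lu Lv k|u v _ _|c u v w Lu Lv Lw|u _].
- split; first by apply: measurable_cst.
  by under eq_integral do rewrite /comp_fun/= mxE expr0n/=; rewrite integral0.
- rewrite (_ : comp_fun _ _ = fun x => c * comp_fun k u x + comp_fun k v x).
    exact: in_L2D.
  by apply/funext => x; rewrite /comp_fun/= !mxE.
- rewrite !ip_rowE; apply: eq_Rintegral => x _.
  by apply: eq_bigr => k _; rewrite mulrC.
- rewrite !ip_rowE -RintegralZl//; last exact: integrable_ip.
  rewrite -RintegralD//; last exact: integrable_ip.
    apply: eq_Rintegral => x _; rewrite mulr_sumr -big_split/=.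
    by apply: eq_bigr => k _; rewrite /comp_fun/= !mxE; ring.
  have := integrableZl mD c (integrable_ip mD Lu Lw).
  by apply: eq_integrable => // x _ /=; rewrite EFinM.
- exact: ip_ge0.
Qed.

Lemma L2norm2 n (D : set 'rV[R]_n) k l (u : 'rV[R]_n -> 'M[R]_(k, l)) :
  L2norm D u ^+ 2 = ip D u u.
Proof. by rewrite sqr_sqrtr// ip_ge0. Qed.

Lemma eq_ip n (D : set 'rV[R]_n) k l (u u' v v' : 'rV[R]_n -> 'M[R]_(k, l)) :
  {in D, u =1 u'} -> {in D, v =1 v'} -> ip D u v = ip D u' v'.
Proof.
by move=> uu' vv'; apply: eq_Rintegral => x Dx; rewrite (uu' _ Dx) (vv' _ Dx).
Qed.

(** The representative is chosen by [xget] from the set of weak derivatives, and this set sees the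
    function only through integrals over [D]. Equal sets give the same choice. *)
Lemma eq_weak_partial n (D : set 'rV[R]_n) i f g :
  {in D, f =1 g} -> weak_partial D i f = weak_partial D i g.
Proof.
move=> fg; rewrite /weak_partial; congr (xget _ _); apply/seteqP.
suff sub (f1 f2 : 'rV[R]_n -> R) : {in D, f1 =1 f2} ->
    [set h | weak_derivative D i f1 h] `<=` [set h | weak_derivative D i f2 h].
  by split; apply: sub => // x Dx; rewrite fg.
move=> f12 h [L2h hP]; split => // phi /hP <-.
by apply: eq_Rintegral => x Dx; rewrite f12.
Qed.

Lemma eq_H1norm n (D : set 'rV[R]_n) m (u v : 'rV[R]_n -> 'rV[R]_m) :
  {in D, u =1 v} -> H1norm D u = H1norm D v.
Proof.
move=> uv; rewrite /H1norm (eq_ip uv uv); congr (Num.sqrt (_ + _)).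
have juv : jac D u = jac D v.
  apply/funext => x; apply/matrixP => k i; rewrite !mxE.
  rewrite (@eq_weak_partial _ _ _ _ (comp_fun k v))// => y Dy.
  by rewrite /comp_fun uv.
by rewrite juv.
Qed.

Section Elastic.
Variables (n m : nat) (D : set 'rV[R]_n) (W : set ('rV[R]_n -> 'rV[R]_m)).
Variable a : ('rV[R]_n -> 'rV[R]_m) -> ('rV[R]_n -> 'rV[R]_m) -> R.
Variable beta : R.
Hypotheses (WP : closed_subspace_H1 D W) (aP : elastic_form D W a beta).

Lemma semi_inner_elastic : semi_inner W a.
Proof.
case: WP aP => _ W0 WD WZ _ [aC aL [c c0 aco] _]; split => //.
- by move=> k x y Wx Wy; apply: WD => //; exact: WZ.
- by move=> x Wx; apply: le_trans (aco _ Wx); rewrite mulr_ge0 ?sqr_ge0// ltW.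
Qed.

(* All multiples of [z] have the [H1norm] of [0], so that the continuity of [a]
   bounds all the multiples of [a z w] by a same constant. *)
Lemma elastic_form_null z w : {in D, z =1 (fun=> 0)} -> W z -> W w -> a z w = 0.
Proof.
move=> z0 Wz Ww; case: (aP) => _ _ _ abd.
set N := H1norm D (0 : 'rV[R]_n -> 'rV[R]_m).
have bd c : c * a z w <= beta * N * H1norm D w.
  rewrite -(semi_innerZl semi_inner_elastic)//.
  have Wcz : W (c *: z) by exact: (semi_inner_memZ semi_inner_elastic c Wz).
  rewrite -(_ : H1norm D (c *: z) = N); first exact: abd.
  apply: eq_H1norm => x Dx.
  by rewrite (_ : (c *: z) x = c *: z x)// z0// scaler0.
apply/eqP; apply: contraT => azw.
(* This multiple would exceed the common bound by 1. *)
have := bd ((beta * N * H1norm D w + 1) / a z w).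
by rewrite divfK// gerDl ler10.
Qed.

Lemma energy_norm2 w : W w -> energy_norm a w ^+ 2 = a w w.
Proof.
by move=> Ww; rewrite sqr_sqrtr// (semi_inner_ge0 semi_inner_elastic).
Qed.

Lemma sub_H1_L2v : W `<=` @L2v n D m.
Proof. by case: WP => WH1 _ _ _ _ w /WH1 H1w k; case: (H1w k). Qed.

End Elastic.

Lemma P1vB n (D : set 'rV[R]_n) T m (u v : 'rV[R]_n -> 'rV[R]_m) :
  P1v D T u -> P1v D T v -> P1v D T (u - v).
Proof.
move=> Pu Pv k; have [cu au] := Pu k; have [cv av] := Pv k.
have -> : comp_fun k (u - v) = fun x => comp_fun k u x - comp_fun k v x.
  by apply/funext => x; rewrite /comp_fun/= !mxE.
split=> [x|K KT]; first by apply: cvgB; [exact: cu|exact: cv].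
have [a1 [b1 e1]] := au K KT; have [a2 [b2 e2]] := av K KT.
exists (a1 - a2), (b1 - b2) => x Kx; rewrite e1// e2// mulmxBr !mxE.
by ring.
Qed.

Lemma polygonal_domain_measurable n (D : set 'rV[R]_n) :
  polygonal_domain D -> measurable D.
Proof.
move=> [_ _ [T [_ ->]]]; apply: open_measurable_rV; exact: open_interior.
Qed.

Lemma stab_ge0 n (D : set 'rV[R]_n) T gamma p : 0 < gamma ->
  0 <= stab D T gamma p p.
Proof.
move=> g0; apply: mulr_ge0; first exact: ltW.
by apply: sumr_ge0 => K _; rewrite mulr_ge0 ?sqr_ge0 ?ip_ge0.
Qed.
End Analysis.

(** One step costs the factor 1/(1 - delta) = 1 + delta/(1 - delta), at most exp(delta/(1 - delta)).
    The accumulated sum of [G] is carried through the induction together with [F], since enlarging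
    it by this factor is harmless. *)
Lemma discrete_gronwall {R : realType} (F G : nat -> R) (delta : R) (n : nat) :
  0 <= delta < 1 -> (forall k, 0 <= F k) -> (forall k, 0 <= G k) ->
  (forall k, (1 - delta) * F k.+1 + G k.+1 <= F k) ->
  F n + \sum_(1 <= k < n.+1) G k <= expR (n%:R * (delta / (1 - delta))) * F 0%N.
Proof.
move=> /andP[d0 d1] F0 G0 step.
have D0 : 0 < 1 - delta by rewrite subr_gt0.
elim: n => [|n IH]; first by rewrite big_geq// mul0r expR0 mul1r addr0.
rewrite big_nat_recr//=; set S := \sum_(_ <= _ < _) _ in IH *.
have S0 : 0 <= S by apply: sumr_ge0.
rewrite -natr1 mulrDl mul1r expRD [_ * expR (_ / _)]mulrC -mulrA.
apply: le_trans (ler_wpM2l (expR_ge0 _) IH).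
apply: (@le_trans _ _ ((1 - delta)^-1 * (F n + S))); last first.
  apply: ler_wpM2r; first by rewrite addr_ge0.
  apply: le_trans (expR_ge1Dx _).
  rewrite le_eqVlt; apply/orP; left; apply/eqP; field; by rewrite gt_eqF.
rewrite mulrC ler_pdivlMr// addrA mulrDl.
by have := step n; have := G0 n.+1; nra.
Qed.

(** * The abstract step applied to the fluid-structure scheme *)

Section SchemeBounds.
Set Implicit Arguments.
Unset Strict Implicit.
Context {R : realType} (d m : nat).
Variables (Om : set 'rV[R]_d) (Sig : set 'rV[R]_m).
Variable phi0 : 'rV[R]_m -> 'rV[R]_d.
Hypotheses (mOm : measurable Om) (mSig : measurable Sig).
Variables (rhof rhos eps mu gamma betas : R).
Hypotheses (rhof0 : 0 < rhof) (rhos0 : 0 < rhos) (eps0 : 0 < eps).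
Hypotheses (mu0 : 0 < mu) (gamma0 : 0 < gamma) (betas0 : 0 < betas).
Variable W : set ('rV[R]_m -> 'rV[R]_d).
Hypothesis WP : closed_subspace_H1 Sig W.
Variable a : ('rV[R]_m -> 'rV[R]_d) -> ('rV[R]_m -> 'rV[R]_d) -> R.
Hypothesis aP : elastic_form Sig W a betas.
Variables (T : seq 'M[R]_(d.+1, d)) (S : seq 'M[R]_(m.+1, m)).
Variables (L : ('rV[R]_m -> 'rV[R]_d) -> ('rV[R]_m -> 'rV[R]_d)).
Hypothesis LP : discrete_elastic_operator Sig W a (Wh Sig W S) L.
Variables (tau : R) (r : nat).
Hypothesis tau0 : 0 < tau.
Variables (u : nat -> 'rV[R]_d -> 'rV[R]_d) (p : nat -> 'rV[R]_d -> R).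
Variables (disp vel dhalf lam : nat -> 'rV[R]_m -> 'rV[R]_d).
Hypothesis algo : algorithm3 Om Sig phi0 rhof rhos eps mu gamma a T S W tau
  u p disp vel dhalf lam r.

Let E := energy Om Sig rhof rhos eps a u disp vel.
Let D := dissipation Om Sig rhof rhos eps gamma a T tau u p disp vel.
Let rho := rhos * eps.
Let k := tau / rho.
Let rho0 : 0 < rho. Proof. exact: mulr_gt0. Qed.
Let k0 : 0 < k. Proof. exact: divr_gt0. Qed.
Let krho : k * rho = tau. Proof. by rewrite divfK// gt_eqF. Qed.
Let aS := semi_inner_elastic WP aP.
Let WL2 := @sub_H1_L2v _ _ _ _ _ WP.
Let ipS := semi_inner_ip d mSig.
Let ipO := semi_inner_ip d mOm.
Let WhW : Wh Sig W S `<=` W. Proof. by move=> w []. Qed.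

Let uL2 n : L2v Om (u n).
Proof. by case: algo => /(_ n)[[[H1u _] _] _ _] _ _ _ _ i; case: (H1u i). Qed.
Let dispW n : Wh Sig W S (disp n). Proof. by case: algo => /(_ n)[]. Qed.
Let velW n : Wh Sig W S (vel n). Proof. by case: algo => /(_ n)[]. Qed.
Let dhalfW n : Wh Sig W S (dhalf n.+1).
Proof. by case: algo => _ /(_ n.+1 isT)[]. Qed.
Let WhB x y : Wh Sig W S x -> Wh Sig W S y -> Wh Sig W S (x - y).
Proof.
move=> [Wx Px] [Wy Py]; split; last exact: P1vB.
exact: (semi_inner_memB aS).
Qed.

Lemma energyE n : E n =
  rhof * ip Om (u n) (u n) + rho * ip Sig (vel n) (vel n) + a (disp n) (disp n).
Proof. by rewrite /E /energy !L2norm2 (energy_norm2 WP aP)//; exact: WhW. Qed.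

Lemma energy_ge0 n : 0 <= E n.
Proof.
by rewrite !addr_ge0// ?sqr_ge0// mulr_ge0 ?sqr_ge0// ltW.
Qed.

(** The summand of [D] at time [n]: the factor tau^2 has been cancelled against the difference
    quotients. *)
Definition dissipated n : R :=
  tau * (ip Om (strain Om (u n)) (strain Om (u n))
    + stab Om T gamma (p n) (p n))
  + (rhof * ip Om (u n - u n.-1) (u n - u n.-1)
     + rho * ip Sig (vel n - vel n.-1) (vel n - vel n.-1)
     + a (disp n - disp n.-1) (disp n - disp n.-1)).

Lemma dissipationE n : D n = \sum_(1 <= i < n.+1) dissipated i.
Proof.
rewrite /D /dissipation !mulr_sumr -big_split/=; apply: eq_bigr => i _.
have ti : tau ^+ 2 * (tau^-1 * tau^-1) = 1 by field; rewrite gt_eqF.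
have dW : W (disp i - disp i.-1) by exact/WhW/WhB.
have duL2 : L2v Om (u i - u i.-1) by exact: (semi_inner_memB ipO).
have dvL2 : L2v Sig (vel i - vel i.-1) by exact/WL2/WhW/WhB.
rewrite (energy_norm2 WP aP); last exact: (semi_inner_memZ aS).
rewrite !L2norm2 /stab_norm sqr_sqrtr ?stab_ge0// /dtau /dissipated.
have ZZ (V : lmodType R) (P : set V) b x : semi_inner P b -> P x ->
    b (tau^-1 *: x) (tau^-1 *: x) = tau^-1 * tau^-1 * b x x.
  move=> bP Px; have Pcx := semi_inner_memZ bP tau^-1 Px.
  by rewrite (semi_innerZl bP)// (semi_innerZr bP)// mulrA.
rewrite (ZZ _ _ _ _ ipO duL2) (ZZ _ _ _ _ ipS dvL2) (ZZ _ _ _ _ aS dW).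
congr (_ + _); rewrite -/rho.
set X := ip Om _ _; set Y := ip Sig _ _; set Z := a _ _.
by rewrite -[RHS]mul1r -ti; ring.
Qed.

(** What the fluid contributes to the first substep tested with its own solution; it is the [F] of
    the abstract step. *)
Let power n : R :=
  rhof * ip Om (dtau tau u n) (u n)
  + 2 * mu * ip Om (strain Om (u n)) (strain Om (u n))
  + stab Om T gamma (p n) (p n).

Lemma fluid_power n : 2 * tau * power n.+1 =
  rhof * (ip Om (u n.+1) (u n.+1) - ip Om (u n) (u n)
    + ip Om (u n.+1 - u n) (u n.+1 - u n))
  + 4 * mu * tau * ip Om (strain Om (u n.+1)) (strain Om (u n.+1))
  + 2 * tau * stab Om T gamma (p n.+1) (p n.+1).
Proof.
rewrite /power /dtau /= (semi_innerZl ipO)//; last exact: (semi_inner_memB ipO).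
rewrite (semi_innerBB ipO)// (semi_innerBl ipO)//.
rewrite (semi_innerC ipO (uL2 n) (uL2 n.+1)).
by field; rewrite gt_eqF.
Qed.

Lemma first_substep n :
  power n.+1 + rho / tau * ip Sig (dhalf n.+1 - vel n) (dhalf n.+1) =
  - a (extrapolation tau disp vel r n.+1) (dhalf n.+1).
Proof.
case: algo => /(_ n.+1)[Vu _ _] /(_ n.+1 isT)[Qp Wd Ll] _ /(_ n.+1 isT) + _.
move=> /(_ _ _ _ _ Vu Qp Wd Ll) <-; rewrite /power /fluid_form /rho; ring.
Qed.

Lemma second_substep n z : Wh Sig W S z ->
  rho / tau * ip Sig (vel n.+1 - dhalf n.+1) z
  + a (disp n.+1 - extrapolation tau disp vel r n.+1) z = 0.
Proof. by case: algo => _ _ _ _ /(_ n.+1 isT)[_]; exact. Qed.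

(** The relation between displacement and velocity holds on [Sig] only, whereas [a] acts on total
    functions; [elastic_form_null] bridges the gap. *)
Lemma elastic_velocity n z : W z ->
  a (disp n.+1 - disp n) z = tau * a (vel n.+1) z.
Proof.
move=> Wz; have Wd := WhW (WhB (dispW n.+1) (dispW n)).
have Wv := WhW (velW n.+1).
have Wtv := semi_inner_memZ aS tau Wv.
rewrite -(semi_innerZl aS tau Wv Wz); apply/eqP; rewrite -subr_eq0.
rewrite -(semi_innerBl aS Wd Wtv Wz); apply/eqP.
apply: (elastic_form_null WP aP) => //; last exact: (semi_inner_memB aS).
move=> x /set_mem Sx; case: algo => _ _ _ _ /(_ n.+1 isT)[/(_ x Sx) vx _].
rewrite (_ : (_ - _) x = disp n.+1 x - disp n x - tau *: vel n.+1 x)// -vx.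
rewrite (_ : dtau _ _ _ x = tau^-1 *: (disp n.+1 x - disp n x))//.
by rewrite scalerA divff ?gt_eqF// scale1r subrr.
Qed.

Let extrapolationW n : W (extrapolation tau disp vel r n.+1).
Proof.
case: r => [|[|r']] /=; first by case: WP.
  exact: WhW.
by case: WP => _ _ WD WZ _; apply: WD; [exact: WhW|apply/WZ/WhW].
Qed.

(** The 4 compensates the coefficient rho/4 of the velocity increment for order 0. The inverse of
    [mu] compensates the viscous term, which the balance provides with the factor [mu] and [D]
    counts without it. *)
Let C : R := 4 + mu^-1.

Let C_ge0 : 0 <= C. Proof. by rewrite addr_ge0 ?invr_ge0// ltW. Qed.

Let C4 x : 0 <= x -> 4 * x <= C * x.
Proof. by move=> x0; rewrite ler_wpM2r// lerDl invr_ge0 ltW. Qed.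

Let Cmu x : 0 <= x -> x <= C * (mu * x).
Proof.
move=> x0; rewrite mulrA /C mulrDl mulVf ?gt_eqF// mulrDl mul1r lerDr.
by rewrite !mulr_ge0// ltW.
Qed.

Let du n := ip Om (u n.+1 - u n) (u n.+1 - u n).
Let dv n := ip Sig (vel n.+1 - vel n) (vel n.+1 - vel n).
Let dd n := a (disp n.+1 - disp n) (disp n.+1 - disp n).
Let st n := ip Om (strain Om (u n)) (strain Om (u n)).
Let sp n := stab Om T gamma (p n) (p n).

Let diss_ge0 n : [/\ 0 <= rhof * du n, 0 <= rho * dv n, 0 <= dd n,
  0 <= tau * st n.+1 & 0 <= tau * sp n.+1].
Proof.
split; last 2 first.
- by rewrite mulr_ge0 ?ip_ge0// ltW.
- by rewrite mulr_ge0 ?stab_ge0// ltW.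
- by rewrite mulr_ge0 ?ip_ge0// ltW.
- by rewrite mulr_ge0 ?ip_ge0// ltW.
- by apply: (semi_inner_ge0 aS); exact/WhW/WhB.
Qed.

Let G n := energy_step (@ip R m Sig 1 d) a rho tau (power n.+1)
  (disp n.+1) (disp n) (vel n.+1) (vel n).

Let GE n : G n = E n.+1 - E n + rhof * du n + 4 * (mu * (tau * st n.+1))
  + 2 * (tau * sp n.+1) + dd n.
Proof.
rewrite /G /energy_step fluid_power !energyE /du /dd /st /sp; ring.
Qed.

Let dissipatedS n : dissipated n.+1 =
  tau * st n.+1 + tau * sp n.+1 + rhof * du n + rho * dv n + dd n.
Proof. rewrite /dissipated /du /dv /dd /st /sp /=; ring. Qed.

Let dissipated_ge0 n : 0 <= dissipated n.
Proof.
have d0 : 0 <= a (disp n - disp n.-1) (disp n - disp n.-1).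
  exact/(semi_inner_ge0 aS)/WhW/WhB.
apply: addr_ge0.
  by rewrite (mulr_ge0 (ltW tau0))// addr_ge0 ?ip_ge0 ?stab_ge0.
by rewrite !addr_ge0// mulr_ge0 ?ip_ge0// ltW.
Qed.

(** * One-step estimates for the three extrapolation orders *)

Lemma scheme_step0 n : r = 0%N ->
  G n + rho / 4 * ip Sig (vel n.+1 - vel n) (vel n.+1 - vel n)
  + tau * k / 2 * ip Sig (L (disp n.+1)) (L (disp n.+1)) <= 0.
Proof.
move=> r0.
apply: (energy_step_order0 ipS aS WL2 WhW LP krho k0 (dispW n.+1) (dispW n)
  (velW n.+1) (velW n) (dhalfW n) (extrapolationW n) (first_substep n) _ _
  rho0).
- exact: second_substep.
- exact: elastic_velocity.
- by rewrite r0.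
Qed.

Lemma scheme_step1 n : r = 1%N ->
  G n + rho * ip Sig (vel n.+1 - vel n) (vel n.+1 - vel n)
  + tau ^+ 2 * (a (vel n.+1) (vel n.+1) - a (vel n) (vel n)
      + a (vel n.+1 - vel n) (vel n.+1 - vel n))
  + tau * k * ip Sig (L (disp n.+1 - disp n)) (L (disp n.+1 - disp n))
  + tau * k * (ip Sig (L (disp n.+1)) (L (disp n.+1))
      - ip Sig (L (disp n)) (L (disp n))) = 0.
Proof.
move=> r1.
apply: (energy_step_order1 ipS aS WL2 WhW LP krho k0 (dispW n.+1) (dispW n)
  (velW n.+1) (velW n) (dhalfW n) (extrapolationW n) (first_substep n) _ _
  rho0).
- exact: second_substep.
- exact: elastic_velocity.
- by rewrite r1.
Qed.

Lemma scheme_step2 n (K : R) : r = 2%N -> 0 <= K ->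
  (forall w, Wh Sig W S w -> a w w <= K * ip Sig w w) ->
  G n + rho / 2 * ip Sig (vel n.+1 - vel n) (vel n.+1 - vel n)
  + 2 * tau ^+ 2 * a (vel n.+1 - vel n) (vel n.+1 - vel n)
  <= 2 * (tau * k * K) ^+ 3 * a (disp n.+1) (disp n.+1).
Proof.
move=> r2 K0 inv.
apply: (energy_step_order2 ipS aS WL2 WhW LP krho k0 (dispW n.+1) (dispW n)
  (velW n.+1) (velW n) (dhalfW n) (extrapolationW n) (first_substep n) _ _
  rho0 K0 inv).
- exact: second_substep.
- exact: elastic_velocity.
- exact: WhB.
- by rewrite r2.
Qed.

(** * Summation over the time steps *)

Let tauk : tau * k = tau ^+ 2 / rho. Proof. by rewrite /k; ring. Qed.

Let tauk_ge0 x : 0 <= x -> 0 <= tau * k * x.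
Proof. by move=> x0; apply: mulr_ge0 => //; apply/ltW/mulr_gt0. Qed.

Let nL2 w : L2norm Sig (L w) ^+ 2 = ip Sig (L w) (L w).
Proof. exact: L2norm2. Qed.

Let CE_ge0 n : 0 <= C * E n.
Proof. by rewrite mulr_ge0 ?energy_ge0. Qed.

Let C_ge n : E n <= C * E n.
Proof. by apply: le_trans (C4 (energy_ge0 n)); have := energy_ge0 n; lra. Qed.

Let no_growth (F g : nat -> R) n :
  (forall i, 0 <= F i) -> (forall i, 0 <= g i) ->
  (forall i, F i.+1 + g i.+1 <= F i) -> F n + \sum_(1 <= i < n.+1) g i <= F 0%N.
Proof.
move=> F0 g0 Fg; have := @discrete_gronwall R F g 0 n.
rewrite mul0r mulr0 expR0 mul1r; apply=> //; first by rewrite lexx ltr01.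
by move=> i; rewrite subr0 mul1r.
Qed.

Lemma stability0 n : r = 0%N ->
  E n + D n + tau ^+ 2 / (4 * rhos * eps) *
    (\sum_(1 <= i < n.+1) L2norm Sig (L (disp i)) ^+ 2) <= C * E 0%N.
Proof.
move=> r0.
have -> : tau ^+ 2 / (4 * rhos * eps) = tau * k / 4.
  by rewrite tauk /rho; field; rewrite !gt_eqF.
pose g i := dissipated i + tau * k / 4 * ip Sig (L (disp i)) (L (disp i)).
have LL i : 0 <= tau * k * ip Sig (L (disp i)) (L (disp i)).
  exact/tauk_ge0/ip_ge0.
apply: le_trans (@no_growth (fun i => C * E i) g n CE_ge0 _ _).
- rewrite dissipationE mulr_sumr -addrA -big_split/=.
  under eq_bigr do rewrite nL2.
  by rewrite lerD2r; exact: C_ge.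
- by move=> i; rewrite addr_ge0//; have := LL i; lra.
(* Multiplied by [C], the one-step estimate dominates [g] term by term. *)
- move=> i; rewrite /g dissipatedS; have := ler_wpM2l C_ge0 (scheme_step0 i r0).
  rewrite GE -/(dv i); have [x1 x2 x3 x4 x5] := diss_ge0 i; have x6 := LL i.+1.
  move: (C4 x1) (C4 x2) (C4 x3) (Cmu x4) (C4 x5) (C4 x6).
  by move=> *; lra.
Qed.

Lemma stability1 n : r = 1%N ->
  E n + D n
  + tau ^+ 2 / (2 * rhos * eps) *
      (\sum_(1 <= i < n.+1) L2norm Sig (L (disp i - disp i.-1)) ^+ 2)
  + tau ^+ 2 / 2 * (\sum_(1 <= i < n.+1) energy_norm a (vel i - vel i.-1) ^+ 2)
  + tau ^+ 2 / (2 * rhos * eps) * L2norm Sig (L (disp n)) ^+ 2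
  + tau ^+ 2 / 2 * energy_norm a (vel n) ^+ 2
  <= C * (E 0%N + tau ^+ 2 / 2 * energy_norm a (vel 0%N) ^+ 2
          + tau ^+ 2 / (2 * rhos * eps) * L2norm Sig (L (disp 0%N)) ^+ 2).
Proof.
move=> r1.
have -> : tau ^+ 2 / (2 * rhos * eps) = tau * k / 2.
  by rewrite tauk /rho; field; rewrite !gt_eqF.
have nv i : energy_norm a (vel i) ^+ 2 = a (vel i) (vel i).
  by apply: (energy_norm2 WP aP); exact: WhW.
pose LL i := tau * k * ip Sig (L (disp i)) (L (disp i)).
pose vv i := tau ^+ 2 * a (vel i) (vel i).
(* With the factor C/2, [F 0] carries the initial velocity and [L] terms with exactly the weights of
   the right-hand side, while C/2 >= 2 still absorbs the constants on the left. *)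
pose F i := C / 2 * (E i + vv i + LL i).
pose Le i := ip Sig (L (disp i - disp i.-1)) (L (disp i - disp i.-1)).
pose dw i := a (vel i - vel i.-1) (vel i - vel i.-1).
pose g i := dissipated i + tau * k / 2 * Le i + tau ^+ 2 / 2 * dw i.
have LL0 i : 0 <= LL i by exact/tauk_ge0/ip_ge0.
have vv0 i : 0 <= vv i.
  by rewrite mulr_ge0 ?sqr_ge0// (semi_inner_ge0 aS)//; exact: WhW.
have Le0 i : 0 <= tau * k * Le i by exact/tauk_ge0/ip_ge0.
have dw0 i : 0 <= tau ^+ 2 * dw i.
  by rewrite mulr_ge0 ?sqr_ge0// (semi_inner_ge0 aS)//; exact/WhW/WhB.
have Fg : F n + \sum_(1 <= i < n.+1) g i <= F 0%N.
  apply: no_growth => i.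
  - by have := CE_ge0 i; have := C4 (LL0 i); have := C4 (vv0 i);
      have := LL0 i; have := vv0 i; rewrite /F; lra.
  - by have := dissipated_ge0 i; have := Le0 i; have := dw0 i; rewrite /g; lra.
  rewrite /g /F dissipatedS; have := scheme_step1 i r1.
  rewrite GE -/(dv i); have [x1 x2 x3 x4 x5] := diss_ge0 i.
  have x6 := Le0 i.+1; have x7 := dw0 i.+1.
  move: (C4 x1) (C4 x2) (C4 x3) (Cmu x4) (C4 x5) (C4 x6) (C4 x7).
  move=> y1 y2 y3 y4 y5 y6 y7 /(congr1 ( *%R C)); rewrite mulr0.
  move: x6 x7 y6 y7; rewrite /LL /vv /Le /dw /=.
  by move=> *; lra.
rewrite dissipationE !nv !nL2.
under [X in _ + _ * X + _ + _ + _]eq_bigr do rewrite nL2 -/(Le _).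
under [X in _ + _ * X + _ + _]eq_bigr => i _.
  rewrite (energy_norm2 WP aP); last exact/WhW/WhB.
  rewrite -/(dw i); over.
move: Fg; rewrite /g !big_split/= -!mulr_sumr /F.
move: (LL0 n) (vv0 n) (C4 (LL0 n)) (C4 (vv0 n)).
move: (C4 (energy_ge0 n)) (energy_ge0 n) (CE_ge0 0).
by rewrite /LL /vv; move=> *; lra.
Qed.

Lemma stability2 n (alpha hs CI : R) : r = 2%N ->
  inverse_inequality Sig (Wh Sig W S) hs CI ->
  tau ^+ 5 / hs ^+ 6 * (betas ^+ 3 * CI ^+ 6 / (rhos * eps) ^+ 3)
    <= alpha ^+ 5 ->
  0 < alpha -> 2 * tau * alpha ^+ 5 < 1 ->
  tau ^+ 2 * (\sum_(1 <= i < n.+1) energy_norm a (vel i - vel i.-1) ^+ 2)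
  + E n + D n
  <= C * (expR (tau * (\sum_(1 <= i < n.+1)
                 (2 * alpha ^+ 5 / (1 - 2 * tau * alpha ^+ 5)))) * E 0%N).
Proof.
move=> r2 inv cfl al0 al1.
(* Continuity of [a] followed by the inverse inequality bounds a (w, w) by [K] times the squared L^2
   norm. *)
pose K := betas * (CI / hs) ^+ 2.
have K0 : 0 <= K by rewrite mulr_ge0 ?sqr_ge0// ltW.
have invK w : Wh Sig W S w -> a w w <= K * ip Sig w w.
  move=> Ww; case: aP => _ _ _ /(_ _ _ (WhW Ww) (WhW Ww)) /le_trans; apply.
  rewrite -mulrA -expr2 /K -mulrA ler_wpM2l ?(ltW betas0)// -L2norm2 -exprMn.
  have H0 : 0 <= H1norm Sig w by exact: sqrtr_ge0.
  by rewrite lerXn2r ?nnegrE//; [exact: le_trans (inv _ Ww)|exact: inv].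
pose delta := 2 * tau * alpha ^+ 5.
have delta0 : 0 <= delta by rewrite !mulr_ge0 ?exprn_ge0// ltW.
(* The left side is 2 tau times the left side of the step-size condition [cfl]. *)
have Kdelta : 2 * (tau * k * K) ^+ 3 <= delta.
  rewrite /delta -[leRHS]mulrA ler_pM2l//.
  rewrite (_ : (tau * k * K) ^+ 3 = tau *
    (tau ^+ 5 / hs ^+ 6 * (betas ^+ 3 * CI ^+ 6 / (rhos * eps) ^+ 3))).
    by rewrite ler_pM2l.
  by rewrite -!exprVn /k /K /rho; ring.
pose dw i := a (vel i - vel i.-1) (vel i - vel i.-1).
pose g i := tau ^+ 2 * dw i + dissipated i.
have dw0 i : 0 <= tau ^+ 2 * dw i.
  by rewrite mulr_ge0 ?sqr_ge0// (semi_inner_ge0 aS)//; exact/WhW/WhB.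
rewrite dissipationE.
under [X in _ * X + _ + _]eq_bigr => i _.
  rewrite (energy_norm2 WP aP); last exact/WhW/WhB.
  rewrite -/(dw i); over.
rewrite addrAC [X in X + _ + _]mulr_sumr -big_split/= sumr_const_nat subn1 /=.
rewrite -[_ *+ n]mulr_natl.
rewrite (_ : tau * (n%:R * _) = n%:R * (delta / (1 - delta))); last first.
  by rewrite /delta; ring.
rewrite mulrCA [leLHS]addrC.
apply: le_trans
  (@discrete_gronwall R (fun i => C * E i) g delta n _ CE_ge0 _ _).
- by rewrite lerD2r; exact: C_ge.
- by rewrite delta0.
- by move=> i; rewrite addr_ge0.
move=> i; rewrite /g dissipatedS; have := scheme_step2 i r2 K0 invK.
rewrite GE -/(dv i); have [x1 x2 x3 x4 x5] := diss_ge0 i.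
have x6 := dw0 i.+1.
(* The growth term involves the new displacement, so it becomes delta times the new energy and moves
   to the left as the factor 1 - delta of the Gronwall lemma. *)
have Ed : a (disp i.+1) (disp i.+1) <= E i.+1.
  by rewrite energyE lerDr addr_ge0// mulr_ge0 ?ip_ge0// ltW.
have aE : 2 * (tau * k * K) ^+ 3 * a (disp i.+1) (disp i.+1) <= delta * E i.+1.
  apply: ler_pM => //; last exact/(semi_inner_ge0 aS)/WhW.
  by rewrite mulr_ge0// exprn_ge0//; exact: tauk_ge0.
move=> /le_trans/(_ aE)/(ler_wpM2l C_ge0).
move: x6 (C4 x1) (C4 x2) (C4 x3) (Cmu x4) (C4 x5) (C4 x6); rewrite /dw /=.
by move=> *; lra.
Qed.

End SchemeBounds.

Theorem theorem4p3p3 (R : realType) (d : nat) (hd : d = 2%N \/ d = 3%N)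
  (Om : set 'rV[R]_d) (hOm : polygonal_domain Om)
  (Sig : set 'rV[R]_d.-1) (hSig : polygonal_domain Sig)
  (phi0 : 'rV[R]_d.-1 -> 'rV[R]_d) (hphi0 : phi0 @` Sig `<=` Om)
  (rhof rhos eps mu gamma : R) (hrhof : 0 < rhof) (hrhos : 0 < rhos)
  (heps : 0 < eps) (hmu : 0 < mu) (hgamma : 0 < gamma)
  (W : set ('rV[R]_d.-1 -> 'rV[R]_d)) (hW : closed_subspace_H1 Sig W)
  (a : ('rV[R]_d.-1 -> 'rV[R]_d) -> ('rV[R]_d.-1 -> 'rV[R]_d) -> R)
  (betas : R) (hbetas : 0 < betas) (ha : elastic_form Sig W a betas)
  (I : Type)
  (T : I -> seq 'M[R]_(d.+1, d)) (hT : forall h, triangulation Om (T h))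
  (hTreg : regular_family T)
  (S : I -> seq 'M[R]_(d.-1.+1, d.-1))
  (hS : forall h, triangulation Sig (S h)) (hSqu : quasi_uniform_family S)
  (CI : R) (hCI : 0 < CI)
  (hinv : forall h, inverse_inequality Sig (Wh Sig W (S h))
                      (mesh_size (S h)) CI)
  (L : I -> ('rV[R]_d.-1 -> 'rV[R]_d) -> ('rV[R]_d.-1 -> 'rV[R]_d))
  (hL : forall h, discrete_elastic_operator Sig W a (Wh Sig W (S h)) (L h)) :
  exists2 C : R, 0 < C &
    forall (h : I) (tau : R) (r : nat)
      (u : nat -> 'rV[R]_d -> 'rV[R]_d) (p : nat -> 'rV[R]_d -> R)
      (disp vel dhalf lam : nat -> 'rV[R]_d.-1 -> 'rV[R]_d),
    0 < tau ->
    algorithm3 Om Sig phi0 rhof rhos eps mu gamma a (T h) (S h) W tau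
      u p disp vel dhalf lam r ->
    let E := energy Om Sig rhof rhos eps a u disp vel in
    let D := dissipation Om Sig rhof rhos eps gamma a (T h) tau
               u p disp vel in
    let nL w := L2norm Sig (L h w) in
    let ns w := energy_norm a w in
    let hs := mesh_size (S h) in
    forall n : nat, (1 <= n)%N ->
    [/\ (r = 0%N ->
          E n + D n
          + tau ^+ 2 / (4 * rhos * eps) *
              (\sum_(1 <= m < n.+1) nL (disp m) ^+ 2)
          <= C * E 0%N),
        (r = 1%N ->
          E n + D n
          + tau ^+ 2 / (2 * rhos * eps) *
              (\sum_(1 <= m < n.+1) nL (disp m - disp m.-1) ^+ 2)
          + tau ^+ 2 / 2 * (\sum_(1 <= m < n.+1) ns (vel m - vel m.-1) ^+ 2)
          + tau ^+ 2 / (2 * rhos * eps) * nL (disp n) ^+ 2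
          + tau ^+ 2 / 2 * ns (vel n) ^+ 2
          <= C * (E 0%N + tau ^+ 2 / 2 * ns (vel 0%N) ^+ 2
                  + tau ^+ 2 / (2 * rhos * eps) * nL (disp 0%N) ^+ 2)) &
        (r = 2%N -> forall alpha : R, 0 < alpha ->
          tau ^+ 5 / hs ^+ 6 * (betas ^+ 3 * CI ^+ 6 / (rhos * eps) ^+ 3)
            <= alpha ^+ 5 ->
          2 * tau * alpha ^+ 5 < 1 ->
          tau ^+ 2 * (\sum_(1 <= m < n.+1) ns (vel m - vel m.-1) ^+ 2)
          + E n + D n
          <= C * (expR (tau * (\sum_(1 <= m < n.+1)
                     (2 * alpha ^+ 5 / (1 - 2 * tau * alpha ^+ 5))))
                  * E 0%N))].
Proof.
have mOm := polygonal_domain_measurable hOm.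
have mSig := polygonal_domain_measurable hSig.
(* The constant depends on the viscosity alone, hence is uniform in the meshes, the time step, the
   number of steps and the initial data. *)
exists (4 + mu^-1) => [|h tau r u p disp vel dhalf lam tau0 algo E D nL ns hs n
  _].
  by rewrite addr_gt0 ?invr_gt0.
split.
- by apply: (stability0 mOm mSig _ _ _ _ _ hW ha (hL h) tau0 algo).
- by apply: (stability1 mOm mSig _ _ _ _ _ hW ha (hL h) tau0 algo).
- move=> r2 alpha al0 cfl al1.
  by apply: (stability2 mOm mSig _ _ _ _ _ hbetas hW ha (hL h) tau0
    algo _ r2 (hinv h) cfl al0 al1).
Qed.
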